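(* Let $(\mathcal S,\mathcal Q,\Theta)$ be a Pufferfish scenario, $(\mathcal U,\omega)$ a continuous or finite slice profile, $\alpha>1$, $\epsilon>0$, and $f:\mathcal X\to\mathbb R^d$ a query. Let $\overline\Delta^2:=\int_{\mathbb S^{d-1}}(\Delta^u_\infty)^2\,d\omega(u)$. Then the mechanism $\mathcal M(X)=f(X)+N$, with $N\sim\mathcal N\!\left(0,\frac{\alpha\overline\Delta^2}{2\epsilon}I_d\right)$ independent of $X$, satisfies $(\alpha,\epsilon,\omega)$-Ave-SRPP in $(\mathcal S,\mathcal Q,\Theta)$.
   Context: Pufferfish scenario: secrets $\mathcal S$, pairs $\mathcal Q\subseteq\mathcal S\times\mathcal S$, priors $\Theta$; each $\theta$ is a joint law of secret $S$ and dataset $X$, with secret marginal $P^S_\theta$. $P^{f,s}_\theta$ is the law of $f(X)$ given $S=s$ under $\theta$; $\mathcal M^\theta_s$ the law of $\mathcal M(X)$ given $S=s$ under $\theta$. Slice profile $(\mathcal U,\omega)$: $\mathcal U\subseteq\mathbb S^{d-1}$ (unit sphere), $\omega$ a probability measure on $\mathbb S^{d-1}$ supported on $\mathcal U$. $\Psi^u(a)=\langle a,u\rangle$; $\Psi^u_\#$ pushforward. For measures on $\mathbb R$, $W_\infty(\nu,\mu)=\inf_{\pi\in\Pi(\nu,\mu)}\sup_{(x,y)\in\mathrm{supp}\,\pi}|x-y|$. Per-slice sensitivity: $\Delta^u_\infty:=\max_{(s_i,s_j)\in\mathcal Q,\theta\in\Theta}W_\infty(\Psi^u_\#P^{f,s_i}_\theta,\Psi^u_\#P^{f,s_j}_\theta)$.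 R\'enyi divergence $\mathtt D_\alpha(P\|Q)=\frac1{\alpha-1}\log\mathbb E_Q[(dP/dQ)^\alpha]$. $\mathtt{AveSD}^\omega_\alpha(P\|Q)=\int\mathtt D_\alpha(\Psi^u_\#P\|\Psi^u_\#Q)\,d\omega(u)$. $\mathcal M$ is $(\alpha,\epsilon,\omega)$-Ave-SRPP in $(\mathcal S,\mathcal Q,\Theta)$ if $\mathtt{AveSD}^\omega_\alpha(\mathcal M^\theta_{s_i}\|\mathcal M^\theta_{s_j})\le\epsilon$ for all $\theta\in\Theta$ and $(s_i,s_j)\in\mathcal Q$ with $P^S_\theta(s_i),P^S_\theta(s_j)>0$. *)

(* Defs.v *)
From HB Require Import structures.
From mathcomp Require Import all_boot all_order all_algebra.
From mathcomp Require Import all_classical all_reals all_analysis.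
Set Implicit Arguments. Unset Strict Implicit. Unset Printing Implicit Defensive.
Import Order.TTheory GRing.Theory Num.Theory.
Local Open Scope classical_set_scope.
Local Open Scope ring_scope.

Section SRPP.
Context {R : realType}.

Definition inner {d : nat} (a u : 'rV[R]_d) : R := \sum_(i < d) a 0 i * u 0 i.
Definition unit_sphere (d : nat) : set 'rV[R]_d := [set u | inner u u = 1].
Definition slice_push {d : nat} (u : 'rV[R]_d) (nu : set 'rV[R]_d -> \bar R)
  : set R -> \bar R := fun B => nu [set a | B (inner a u)].

Definition secret_prob {dS dX} {Sec : measurableType dS} {X : measurableType dX}
  (theta : set (Sec * X)%type -> \bar R) (s : Sec) : \bar R :=
  theta [set p | p.1 = s].
Definition cond_query_law {dS dX} {Sec : measurableType dS} {X : measurableType dX}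
  {d : nat} (theta : set (Sec * X)%type -> \bar R) (f : X -> 'rV[R]_d) (s : Sec)
  : set 'rV[R]_d -> \bar R :=
  fun B => (fine (theta [set p | p.1 = s /\ B (f p.2)]) /
            fine (secret_prob theta s))%:E.

Definition is_coupling (nu mu : set R -> \bar R) (pi : probability (R * R)%type R) :=
  forall A : set R, measurable A ->
    pi (A `*` setT) = nu A /\ pi (setT `*` A) = mu A.
Definition supp2 (pi : set (R * R)%type -> \bar R) : set (R * R)%type :=
  [set z : R * R | forall e : R, 0 < e ->
     (0 < pi [set w : R * R | (`|w.1 - z.1| < e)%R /\ (`|w.2 - z.2| < e)%R])%E].
Definition W_inf (nu mu : set R -> \bar R) : \bar R :=
  ereal_inf [set ereal_sup [set (`|z.1 - z.2|)%:E | z in supp2 pi]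
            | pi in [set pi | is_coupling nu mu pi]].

Definition lnE (x : \bar R) : \bar R :=
  match x with
  | r%:E => (ln r)%:E
  | +oo%E => +oo%E
  | -oo%E => -oo%E
  end.
(* D_alpha(P||Q) = 1/(alpha-1) log E_Q[(dP/dQ)^alpha], and +oo if P is not
   absolutely continuous w.r.t. Q (no density exists). The value does not
   depend on the choice of the density (densities agree Q-a.e.). *)
Definition renyi (alpha : R) (P Q : set R -> \bar R) : \bar R :=
  ereal_inf [set v | exists g : R -> R,
    [/\ (forall x, 0 <= g x), measurable_fun setT g,
        (forall A, measurable A -> P A = (\int[Q]_(x in A) (g x)%:E)%E) &
        v = (((alpha - 1)^-1)%:E * lnE (\int[Q]_x ((g x) `^ alpha)%:E))%E]].

(* The slice profile omega is a probability measure on S^{d-1}; it is given as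
   a probability [omega] on a measurable space [D] together with a measurable
   map [dir : D -> S^{d-1}] (omega on the sphere is the pushforward). *)
Definition AveSD {dD} {D : measurableType dD} {d : nat}
  (omega : set D -> \bar R) (dir : D -> 'rV[R]_d) (alpha : R)
  (P Q : set 'rV[R]_d -> \bar R) : \bar R :=
  (\int[omega]_t renyi alpha (slice_push (dir t) P) (slice_push (dir t) Q))%E.

(* (alpha, eps, omega)-Ave-SRPP for a mechanism, given by its conditional
   output laws M^theta_s *)
Definition Ave_SRPP {dS dX dD} {Sec : measurableType dS} {X : measurableType dX}
  {D : measurableType dD} {d : nat}
  (Q : set (Sec * Sec)%type) (Theta : set (probability (Sec * X)%type R))
  (omega : set D -> \bar R) (dir : D -> 'rV[R]_d) (alpha eps : R)
  (M : probability (Sec * X)%type R -> Sec -> set 'rV[R]_d -> \bar R) : Prop :=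
  forall theta si sj, Theta theta -> Q (si, sj) ->
    (0 < secret_prob theta si)%E -> (0 < secret_prob theta sj)%E ->
    (AveSD omega dir alpha (M theta si) (M theta sj) <= eps%:E)%E.

(* max over pairs in Q and priors in Theta for which both conditional laws
   are defined (both secrets have positive prior probability) *)
Definition slice_sens {dS dX} {Sec : measurableType dS} {X : measurableType dX}
  {d : nat} (Q : set (Sec * Sec)%type) (Theta : set (probability (Sec * X)%type R))
  (f : X -> 'rV[R]_d) (u : 'rV[R]_d) : \bar R :=
  ereal_sup [set w | exists theta si sj,
    [/\ Theta theta, Q (si, sj), (0 < secret_prob theta si)%E,
        (0 < secret_prob theta sj)%E &
        w = W_inf (slice_push u (cond_query_law theta f si))
                  (slice_push u (cond_query_law theta f sj))]].

Definition mean_sq_sens {dS dX dD} {Sec : measurableType dS} {X : measurableType dX}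
  {D : measurableType dD} {d : nat}
  (Q : set (Sec * Sec)%type) (Theta : set (probability (Sec * X)%type R))
  (f : X -> 'rV[R]_d) (omega : set D -> \bar R) (dir : D -> 'rV[R]_d) : \bar R :=
  (\int[omega]_t (slice_sens Q Theta f (dir t) * slice_sens Q Theta f (dir t)))%E.

(* one-dimensional N(0, s^2), s the standard deviation (N(0,0) = Dirac at 0) *)
Definition gauss1 (s : R) : set R -> \bar R :=
  if s == 0 then @dirac _ R 0 R else normal_prob 0 s.
(* E[g(N_0, ..., N_{k-1}, v_k, ...)] for i.i.d. N_i ~ mu : iterated integral *)
Fixpoint iter_int (mu : set R -> \bar R) (k : nat) (g : (nat -> R) -> \bar R)
  (v : nat -> R) : \bar R :=
  match k with
  | 0 => g v
  | k'.+1 => (\int[mu]_x iter_int mu k' g (fun i => if i == k' then x else v i))%E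
  end.
(* N(0, s^2 I_d) on R^d: product of d independent N(0, s^2) coordinates *)
Definition gauss_vec (d : nat) (s : R) (E : set 'rV[R]_d) : \bar R :=
  iter_int (gauss1 s) d (fun v => (\1_E (\row_(i < d) v i) : R)%:E) (fun _ => 0).

(* law of M(X) = f(X) + N given S = s under theta, where N ~ N(0, var I_d) is
   independent of (S, X) *)
Definition gauss_mech_law {dS dX} {Sec : measurableType dS} {X : measurableType dX}
  {d : nat} (f : X -> 'rV[R]_d) (var : R)
  (theta : probability (Sec * X)%type R) (s : Sec) : set 'rV[R]_d -> \bar R :=
  fun B => (fine (\int[theta]_(p in [set p | p.1 = s])
                    gauss_vec (d:=d) (Num.sqrt var) [set n : 'rV[R]_d | B (f p.2 + n)%R])%E /
            fine (secret_prob theta s))%:E.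

End SRPP.

(* Main.v *)
(* In every direction [u] the mechanism outputs a mixture of the Gaussians
   [N(y, var)], where [y] follows the [u]-slice of the query law.  A coupling of two
   slice laws with |x - y| <= r almost surely writes both outputs as mixtures over the
   same parameter, and convexity of [(a, b) |-> a ^ alpha * b ^ (1 - alpha)] reduces
   the Renyi divergence to that of two shifted Gaussians,
   [alpha * r ^ 2 / (2 * var)].  Optimising over couplings bounds the divergence by a
   multiple of the squared slice sensitivity, and averaging over the directions
   turns the choice of the variance into the bound [eps].  If the mean squared
   sensitivity vanishes there is no noise, and almost all pairs of slices coincide. *)
Require Import Defs.
From HB Require Import structures.
From mathcomp Require Import all_boot all_order all_algebra.
From mathcomp Require Import all_classical all_reals all_analysis.
From mathcomp Require Import measurable_realfun ring lra.
Import Order.TTheory GRing.Theory Num.Theory.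
Import numFieldNormedType.Exports.
Set Implicit Arguments. Unset Strict Implicit. Unset Printing Implicit Defensive.
Local Open Scope classical_set_scope.
Local Open Scope ring_scope.

(** Query and output laws enter as bare set functions built with [fine]; only their values on
    measurable sets are controlled, so integrals against them are transported to a genuine measure
    before anything is computed. Neither the sensitivity nor the divergence is known to be
    measurable in the direction, which rules out the usual monotonicity of integrals and, without
    noise, the usual step from a vanishing integral to a null set. The infimum in [W_inf] need not
    be attained and may be infinite, so the divergence bound is tested on real numbers below the
    divergence. The noise is an iterated integral over coordinates, so that its slices are Gaussian
    has to be derived from a convolution identity. *)

Section set_function_integral.
Local Open Scope ereal_scope.
Context d (T : measurableType d) (R : realType).
Import HBNNSimple.

(** Integrals are suprema over simple functions, whose level sets are measurable, so values on other
    sets never enter. A law given as a set function can thus be replaced by a genuine measure. *)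
Lemma eq_setfun_integral (m1 m2 : set T -> \bar R) (D : set T) (f : T -> \bar R) :
  (forall A, measurable A -> m1 A = m2 A) ->
  \int[m1]_(x in D) f x = \int[m2]_(x in D) f x.
Proof.
move=> m12.
have sE (h : {nnsfun T >-> R}) : sintegral m1 h = sintegral m2 h.
  by rewrite /sintegral; apply: eq_fsbigr => x _; rewrite m12.
have imE (g : T -> \bar R) :
    [set sintegral m1 h | h in [set h : {nnsfun T >-> R} | forall x, (h x)%:E <= g x]] =
    [set sintegral m2 h | h in [set h : {nnsfun T >-> R} | forall x, (h x)%:E <= g x]].
  by apply/seteqP; split => _ [h hg <-]; exists h.
by rewrite /integral !imE.
Qed.

Lemma eq_setfun_integrand (m : set T -> \bar R) (D : set T) (g f : T -> \bar R) :
  f =1 g -> \int[m]_(x in D) f x = \int[m]_(x in D) g x.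
Proof. by move=> /funext ->. Qed.

(* The integral of a non-measurable nonnegative function is the supremum over the
   simple functions below it, so monotonicity and homogeneity survive. *)
Lemma le_scaled_integral (mu : {measure set T -> \bar R}) (k : R)
    (f g : T -> \bar R) :
  (0 < k)%R -> (forall x, 0 <= g x) -> (forall x, f x <= k%:E * g x) ->
  \int[mu]_x f x <= k%:E * \int[mu]_x g x.
Proof.
move=> k0 g0 fkg; rewrite integralE.
have fn0 : 0 <= \int[mu]_x f^\- x by apply: integral_ge0 => x _; exact: funeneg_ge0.
apply: (@le_trans _ _ (\int[mu]_x f^\+ x)).
  by rewrite -[leRHS]sube0 leeB.
rewrite ge0_integralTE; last by move=> x; exact: funepos_ge0.
apply: ge_ereal_sup => _ [h /= hf <-].
have kV0 : (0 <= k^-1)%R by rewrite invr_ge0 ltW.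
(* The simple function used below [g] is [k^-1 * h]; at points with [f x <= 0] the bounds [h x <= 0]
   and [0 <= g x] suffice. *)
rewrite -(mul1e (sintegral mu h)) -(mulfV (lt0r_neq0 k0)) EFinM -muleA.
rewrite lee_wpmul2l ?lee_fin ?(ltW k0)// -sintegralrM ge0_integralTE//.
apply: ereal_sup_ubound; exists (scale_nnsfun h kV0) => //= x.
rewrite EFinM lee_pdivrMl//.
have := hf x; rewrite funeposE le_max => /orP[/le_trans ->//|].
by move=> /le_trans; apply; rewrite mule_ge0// lee_fin ltW.
Qed.

End set_function_integral.

(** * Integration against the image of a weighted measure *)

Section image_density.
Local Open Scope ereal_scope.
Context d d' (T : measurableType d) (Y : measurableType d') (R : realType).
Variables (mu : {measure set T -> \bar R}) (phi : T -> Y) (q : T -> R).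
Hypotheses (mphi : measurable_fun setT phi) (mq : measurable_fun setT q).
Hypothesis q0 : forall x, (0 <= q x)%R.
Import HBNNSimple.

Let m A := \int[mu]_(x in phi @^-1` A) (q x)%:E.

Let mpre A : measurable A -> measurable (phi @^-1` A).
Proof. by move=> mA; rewrite -(setTI (_ @^-1` _)); exact: mphi. Qed.

Let m_set0 : m set0 = 0. Proof. by rewrite /m preimage_set0 integral_set0. Qed.

Let m_ge0 A : 0 <= m A.
Proof. by apply: integral_ge0 => x _; rewrite lee_fin. Qed.

Let m_sigma_additive : semi_sigma_additive m.
Proof.
move=> A mA tA mUA; rewrite /m preimage_bigcup ge0_integral_bigcup//.
- by apply: is_cvg_ereal_nneg_natsum_cond => n _ _; exact: m_ge0.
- by move=> k; exact: mpre.
- by apply/measurable_EFinP; exact: measurable_funTS.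
- by move=> x _; rewrite lee_fin.
- by move=> i j _ _ [x [Ai Aj]]; apply: tA => //; exists (phi x).
Qed.

HB.instance Definition _ := isMeasure.Build _ _ _ m m_set0 m_ge0 m_sigma_additive.

Lemma image_density_measure : exists nu : {measure set Y -> \bar R},
  forall A, nu A = \int[mu]_(x in phi @^-1` A) (q x)%:E.
Proof. by exists m. Qed.

(** One change of variables serves for substitutions ([q] constant), densities ([phi = id]),
    marginals of couplings ([q = 1]) and conditional laws ([q] a normalised indicator). The
    hypothesis is the case of indicators; linearity and monotone convergence do the rest. *)
Lemma ge0_integral_image_density (nu : set Y -> \bar R) (h : Y -> \bar R) :
  (forall A, measurable A -> nu A = \int[mu]_(x in phi @^-1` A) (q x)%:E) ->
  measurable_fun setT h -> (forall y, 0 <= h y) ->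
  \int[nu]_y h y = \int[mu]_x ((q x)%:E * h (phi x)).
Proof.
move=> nuE mh h0; rewrite (@eq_setfun_integral _ _ _ nu m)//.
pose h_ := nnsfun_approx measurableT mh.
transitivity (limn (fun n => \int[m]_y (h_ n y)%:E)).
  rewrite -monotone_convergence//.
  - by apply: eq_integral => y _; apply/esym/cvg_lim => //; exact: cvg_nnsfun_approx.
  - by move=> n; exact/measurable_EFinP.
  - by move=> n y _; rewrite lee_fin.
  - by move=> y _ a b ab; rewrite lee_fin; exact/lefP/nd_nnsfun_approx.
have mhphi n : measurable_fun setT (fun x => h_ n (phi x)) by exact: measurableT_comp.
transitivity (limn (fun n => \int[mu]_x ((q x)%:E * (h_ n (phi x))%:E))); last first.
  rewrite -monotone_convergence//.
  - apply: eq_integral => x _; apply/cvg_lim => //; apply: cvgeZl => //.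
    exact: cvg_nnsfun_approx.
  - by move=> n; apply/measurable_EFinP; exact: measurable_funM.
  - by move=> n y _; rewrite lee_fin mulr_ge0.
  - move=> y _ a b ab; rewrite lee_fin ler_wpM2l//.
    exact/lefP/nd_nnsfun_approx.
congr (limn _); apply/funext => n.
under [LHS]eq_integral do rewrite fimfunE -fsumEFin//.
rewrite ge0_integral_fsum//; last 2 first.
- by move=> r; exact/measurable_EFinP/measurableT_comp.
- by move=> r x _; rewrite nnfun_muleindic_ge0.
transitivity (\sum_(r \in range (h_ n))
    \int[mu]_x (r * (q x * \1_(h_ n @^-1` [set r]) (phi x)))%:E); last first.
  rewrite -ge0_integral_fsum//; last 2 first.
  - move=> r; apply/measurable_EFinP; apply: measurable_funM => //.
    apply: measurable_funM => //; apply: (measurableT_comp _ mphi).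
    exact: measurable_indic.
  - move=> r x _; rewrite mulrCA EFinM mule_ge0 ?lee_fin//.
    by have := nnfun_muleindic_ge0 (h_ n) r (phi x); rewrite lee_fin.
  apply: eq_integral => x _; rewrite fsumEFin// -EFinM [in RHS]fimfunE.
  rewrite mulr_fsumr//; congr (_%:E); apply: eq_fsbigr => r _.
  by rewrite mulrCA.
apply: eq_fsbigr => r; rewrite inE => -[y _ <-{r}].
rewrite integralZl_indic_nnsfun// integral_indic// setIT.
under eq_integral do rewrite EFinM.
rewrite ge0_integralZl//; last 3 first.
- apply/measurable_EFinP; apply: measurable_funM => //.
  by apply: (measurableT_comp _ mphi); exact: measurable_indic.
- by move=> x _; rewrite lee_fin mulr_ge0.
- by rewrite lee_fin.
congr (_ * _); rewrite /m [LHS]integral_mkcond; apply: eq_integral => x _.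
rewrite patchE /= indicE.
have -> : (x \in phi @^-1` (h_ n @^-1` [set h_ n y])) =
    (phi x \in h_ n @^-1` [set h_ n y]) by apply/idP/idP; rewrite !inE.
by case: ifP => _; rewrite ?mulr1 ?mulr0.
Qed.

End image_density.

(** * Affine substitution in Lebesgue integrals *)

Section affine_substitution.
Context (R : realType).
Local Notation leb := (@lebesgue_measure R).

(** By uniqueness of Lebesgue measure it is enough to compare both sides on intervals []x, y]]; for
    [a < 0] the preimage exchanges the open and the closed end, with the same length. *)
Lemma lebesgue_measure_affine (a b : R) (A : set R) : a != 0 -> measurable A ->
  (lebesgue_measure A = `|a|%:E * lebesgue_measure ((fun x => a * x + b)%R @^-1` A))%E.
Proof.
move=> a0 mA.
have mphi : measurable_fun setT (fun x : R => a * x + b : R).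
  by apply: measurable_funD => //; exact: measurable_funM.
have mphi' : measurable_fun (setT : set (measurableTypeR R))
    (fun x => a * x + b : measurableTypeR R) by exact: mphi.
pose phi : {mfun measurableTypeR R >-> measurableTypeR R} := HB.pack
  (fun x : measurableTypeR R => a * x + b : measurableTypeR R)
  (isMeasurableFun.Build _ _ _ _ _ mphi').
pose k := NngNum (normr_ge0 a).
have := @lebesgue_measure_unique R (mscale k (pushforward leb phi)).
apply => // _ [[x y]/= _ <-].
change (leb `]x, y]%classic =
  (`|a|%:E * leb ((fun x => a * x + b)%R @^-1` `]x, y]%classic))%E).
have [yx|xy] := leP y x.
  rewrite (_ : `]x, y]%classic = set0) ?preimage_set0 ?measure0 ?mule0//.
  apply/seteqP; split => z //=; rewrite in_itv/=.
  by move=> /andP[/lt_le_trans/[apply] /lt_le_trans/(_ yx)]; rewrite ltxx.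
rewrite lebesgue_measure_itv/= lte_fin xy.
have [a_gt0|a_lt0|/esym/eqP] := ltgtP 0 a; last by rewrite (negbTE a0).
- rewrite (_ : _ @^-1` _ = `](x - b) / a, (y - b) / a]%classic); last first.
    apply/seteqP; split => z /=; rewrite !in_itv/= ltr_pdivrMr// ler_pdivlMr//;
      by rewrite [z * a]mulrC ltrBlDr lerBrDr.
  rewrite lebesgue_measure_itv/= lte_fin ltr_pM2r ?invr_gt0// ltrD2r xy.
  rewrite gtr0_norm// -!EFinB -EFinM; congr (_%:E); by field.
- rewrite (_ : _ @^-1` _ = `[(y - b) / a, (x - b) / a[%classic); last first.
    apply/seteqP; split => z /=; rewrite !in_itv/= ltr_ndivlMr// ler_ndivrMr//;
      by rewrite [z * a]mulrC ltrBlDr lerBrDr andbC.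
  rewrite lebesgue_measure_itv/= lte_fin ltr_nM2r ?invr_lt0// ltrD2r xy.
  rewrite ltr0_norm// -!EFinB -EFinM; congr (_%:E); by field.
Qed.

Lemma ge0_integral_affine (a b : R) (h : R -> \bar R) : a != 0 ->
  measurable_fun setT h -> (forall y, 0 <= h y)%E ->
  (\int[leb]_y h y = \int[leb]_x (`|a|%:E * h (a * x + b)%R))%E.
Proof.
move=> a0 mh h0.
have mphi : measurable_fun setT (fun x : R => a * x + b : R).
  by apply: measurable_funD => //; exact: measurable_funM.
apply: (@ge0_integral_image_density _ _ (measurableTypeR R) (measurableTypeR R) R
  leb (fun x : R => a * x + b) (cst `|a|)) => //.
move=> A mA; rewrite (lebesgue_measure_affine b a0 mA).
have mB : measurable ((fun x => a * x + b) @^-1` A).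
  by rewrite -(setTI (_ @^-1` _)); exact: mphi.
exact: (esym (@integral_cst _ (measurableTypeR R) _ leb _ mB _)).
Qed.

End affine_substitution.

(** * Gaussian densities and their convolution *)

Section gauss.
Context (R : realType).
Local Notation leb := (@lebesgue_measure R).
Implicit Types (m s t a : R) (h : R -> \bar R).

Lemma ge0_integral_normal_prob m s h : measurable_fun setT h -> (forall y, 0 <= h y)%E ->
  (\int[normal_prob m s : set R -> \bar R]_y h y = \int[leb]_x ((normal_pdf m s x)%:E * h x))%E.
Proof.
move=> mh h0.
apply: (@ge0_integral_image_density _ _ (measurableTypeR R) R R leb id (normal_pdf m s)) => //.
- exact: measurable_normal_pdf.
- exact: normal_pdf_ge0.
Qed.

Lemma normal_pdf_gt0 m s x : s != 0 -> 0 < normal_pdf m s x.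
Proof. by move=> s0; rewrite normal_pdfE// mulr_gt0 ?normal_peak_gt0 ?expR_gt0. Qed.

Lemma normal_peakE s : 0 < s -> normal_peak s = (s * Num.sqrt (pi *+ 2))^-1.
Proof.
move=> s0; rewrite /normal_peak -mulrnAr sqrtrM ?sqr_ge0// sqrtr_sqr gtr0_norm//.
Qed.

(* Completing the square in [x]. *)
Lemma normal_pdf_mul s t a x z : 0 < s -> 0 < t ->
  let v := Num.sqrt (t ^+ 2 + (a * s) ^+ 2) in
  normal_pdf 0 s x * normal_pdf (a * x) t z =
  normal_pdf 0 v z * normal_pdf (a * s ^+ 2 / v ^+ 2 * z) (s * t / v) x.
Proof.
move=> s0 t0 v.
have v2 : v ^+ 2 = t ^+ 2 + (a * s) ^+ 2.
  by rewrite sqr_sqrtr// addr_ge0 ?sqr_ge0.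
have v0 : 0 < v by rewrite sqrtr_gt0 ltr_pwDl ?sqr_ge0 ?exprn_gt0.
have w0 : 0 < s * t / v by rewrite divr_gt0 ?mulr_gt0.
rewrite !normal_pdfE ?gt_eqF// !normal_peakE//.
rewrite mulrACA [RHS]mulrACA; congr (_ * _).
  rewrite -!invfM; congr (_^-1); field; by rewrite gt_eqF.
rewrite /normal_fun -!expRD; congr expR.
have sn : s != 0 by rewrite gt_eqF.
have tn : t != 0 by rewrite gt_eqF.
have vn : v != 0 by rewrite gt_eqF.
rewrite subr0.
(* This factor clears all denominators; the polynomial form reached second displays the completed
   square, and [v2] makes the two forms agree. *)
apply: (@mulIf _ (2 * s ^+ 2 * t ^+ 2 * v ^+ 2)).
  by rewrite !mulf_neq0 ?expf_neq0 ?pnatr_eq0.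
transitivity (- (x ^+ 2 * t ^+ 2 + (z - a * x) ^+ 2 * s ^+ 2) * v ^+ 2).
  by rewrite -[_ *+ 2]mulr_natr; field; rewrite sn tn.
transitivity (- (z ^+ 2 * s ^+ 2 * t ^+ 2) - (x * v ^+ 2 - a * s ^+ 2 * z) ^+ 2).
  rewrite v2; ring.
by rewrite subr0; field; rewrite sn tn vn.
Qed.

Lemma measurable_normal_pdf_comp d (T : measurableType d) s (f g : T -> R) :
  s != 0 -> measurable_fun setT f -> measurable_fun setT g ->
  measurable_fun setT (fun w => normal_pdf (f w) s (g w)).
Proof.
move=> s0 mf mg.
under eq_fun do rewrite normal_pdfE//.
apply: measurable_funM => //; apply: measurableT_comp => //.
apply: measurable_funM => //; apply: measurableT_comp => //.
by apply: measurable_funX; exact: measurable_funB.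
Qed.

Lemma measurable_addl a : measurable_fun setT (fun x : R => a + x).
Proof. exact: measurable_funD. Qed.

Lemma integral_gauss1_0 h : measurable_fun setT h ->
  (\int[gauss1 0%R]_x h x = h 0%R)%E.
Proof. by move=> mh; rewrite /gauss1 eqxx integral_dirac// diracT mul1e. Qed.

Lemma ge0_integral_gauss1 s h : s != 0 -> measurable_fun setT h ->
  (forall y, 0 <= h y)%E ->
  (\int[gauss1 s]_x h x = \int[leb]_x ((normal_pdf 0%R s x)%:E * h x))%E.
Proof.
by move=> s0 mh h0; rewrite /gauss1 (negbTE s0) ge0_integral_normal_prob.
Qed.

Lemma integral_gauss1_cst s (c : \bar R) : (0 <= c)%E ->
  (\int[gauss1 s]_x c = c)%E.
Proof.
move=> c0; have [->|s0] := eqVneq s 0; first exact: integral_gauss1_0.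
rewrite ge0_integral_gauss1// ge0_integralZr//.
- by rewrite integral_normal_pdf mul1e.
- by apply/measurable_EFinP; exact: measurable_normal_pdf.
- by move=> x _; rewrite lee_fin normal_pdf_ge0.
Qed.

Lemma ge0_integral_gauss1_shift s c h : s != 0 -> measurable_fun setT h ->
  (forall y, 0 <= h y)%E ->
  (\int[gauss1 s]_x h (c + x)%R = \int[leb]_x ((normal_pdf c s x)%:E * h x))%E.
Proof.
move=> s0 mh h0.
have mhc : measurable_fun setT (fun x => h (c + x)).
  by apply: measurableT_comp => //; exact: measurable_addl.
rewrite (ge0_integral_gauss1 s0 mhc (fun x => h0 (c + x))).
rewrite [RHS](@ge0_integral_affine R 1 c)//; last 2 first.
- by apply: emeasurable_funM => //; apply/measurable_EFinP; exact: measurable_normal_pdf.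
- by move=> y; rewrite mule_ge0// lee_fin normal_pdf_ge0.
apply: eq_integral => x _; rewrite normr1 mul1e mul1r [(x + c)%R]addrC.
by congr (_%:E * _)%E; rewrite !normal_pdfE// /normal_fun subr0 [(c + x)%R]addrC addrK.
Qed.

(** The law of [a * x + y] for independent centred Gaussians. Every standard deviation is a multiple
    of [s], so that [s = 0] turns all of them into Dirac masses at once. For [tau = 0] the claim is
    a scaling by [a], again degenerate when [a = 0]; otherwise both densities exist. *)
Lemma gauss1_convolution s tau a h : 0 <= s -> 0 <= tau ->
  measurable_fun setT h -> (forall y, 0 <= h y)%E ->
  (\int[gauss1 s]_x \int[gauss1 (s * tau)%R]_y h (a * x + y)%R =
   \int[gauss1 (s * Num.sqrt (tau ^+ 2 + a ^+ 2))%R]_z h z)%E.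
Proof.
move=> s_ge0 tau_ge0 mh h0.
have mha : measurable_fun setT (fun x : R => h (a * x)).
  by apply: measurableT_comp => //; exact: measurable_funM.
have mhs c : measurable_fun setT (fun x : R => h (c + x)).
  by apply: measurableT_comp => //; exact: measurable_addl.
move: s_ge0; rewrite le_eqVlt => /predU1P[<-|s0].
  rewrite !mul0r [RHS]integral_gauss1_0//.
  under eq_setfun_integrand do rewrite integral_gauss1_0// addr0.
  by rewrite integral_gauss1_0// mulr0.
have sn : s != 0 by rewrite gt_eqF.
move: tau_ge0; rewrite le_eqVlt => /predU1P[<-|tau0].
  under eq_setfun_integrand do rewrite mulr0 integral_gauss1_0// addr0.
  rewrite expr0n/= add0r sqrtr_sqr.
  have [->|a0] := eqVneq a 0.
    under eq_setfun_integrand do rewrite mul0r.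
    by rewrite integral_gauss1_cst// normr0 mulr0 integral_gauss1_0.
  have na0 : 0 < `|a| by rewrite normr_gt0.
  have san : s * `|a| != 0 by rewrite mulf_neq0// gt_eqF.
  rewrite (ge0_integral_gauss1 sn mha)// (ge0_integral_gauss1 san mh h0).
  rewrite [RHS](@ge0_integral_affine R a 0)//; last 2 first.
  - by apply: emeasurable_funM => //; apply/measurable_EFinP; exact: measurable_normal_pdf.
  - by move=> y; rewrite mule_ge0// lee_fin normal_pdf_ge0.
  apply: eq_integral => x _; rewrite addr0 muleA -EFinM; congr (_%:E * _)%E.
  rewrite !normal_pdfE// !normal_peakE ?mulr_gt0// /normal_fun !subr0.
  rewrite mulrA; congr (_ * expR _).
    have pn : Num.sqrt (pi *+ 2) != 0 :> R.
      by rewrite gt_eqF// sqrtr_gt0 mulrn_wgt0// pi_gt0.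
    by field; rewrite pn sn gt_eqF.
  rewrite !exprMn real_normK ?num_real//.
  by field; rewrite a0 sn.
set t := s * tau; have t0 : 0 < t by rewrite mulr_gt0.
have tn : t != 0 by rewrite gt_eqF.
set v := s * Num.sqrt _.
have vE : v = Num.sqrt (t ^+ 2 + (a * s) ^+ 2).
  rewrite /v /t (_ : _ + (a * s) ^+ 2 = s ^+ 2 * (tau ^+ 2 + a ^+ 2)); last by ring.
  by rewrite sqrtrM ?sqr_ge0// sqrtr_sqr gtr0_norm.
have v0 : 0 < v by rewrite vE sqrtr_gt0 ltr_pwDl ?sqr_ge0 ?exprn_gt0.
have vn : v != 0 by rewrite gt_eqF.
under eq_setfun_integrand do rewrite (ge0_integral_gauss1_shift _ tn mh h0).
pose F (w : measurableTypeR R * measurableTypeR R) : \bar R :=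
  ((normal_pdf (a * w.1)%R t w.2)%:E * h w.2)%E.
have mF : measurable_fun setT F.
  apply: emeasurable_funM; last by apply: measurableT_comp.
  apply/measurable_EFinP; apply: measurable_normal_pdf_comp => //.
  by apply: measurable_funM => //.
have F0 w : (0 <= F w)%E by rewrite mule_ge0// lee_fin normal_pdf_ge0.
have mG : measurable_fun setT (fun x => \int[leb]_z F (x, z))%E.
  exact: (@measurable_fun_fubini_tonelli_F _ _ _ _ R leb F).
have G0 x : (0 <= \int[leb]_z F (x, z))%E by apply: integral_ge0 => z _; exact: F0.
rewrite (ge0_integral_gauss1 sn mG G0).
transitivity (\int[leb]_x \int[leb]_z ((normal_pdf 0%R s x)%:E * F (x, z)))%E.
  apply: eq_integral => x _; rewrite ge0_integralZl//.
  - by apply: measurableT_comp => //; exact: pair1_measurable.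
  - by rewrite lee_fin normal_pdf_ge0.
(* After the exchange, the completed square turns the inner integral over [x] into the total mass of
   a normal density. *)
rewrite (@fubini_tonelli _ _ _ _ R leb leb
  (fun w => (normal_pdf 0%R s w.1)%:E * F w)%E)//=; last 2 first.
- apply: emeasurable_funM => //.
  by apply/measurable_EFinP; apply: measurable_normal_pdf_comp.
- by move=> w; rewrite mule_ge0// lee_fin normal_pdf_ge0.
rewrite (ge0_integral_gauss1 vn mh h0); apply: eq_integral => z _.
under eq_integral.
  move=> x _; rewrite /F /= muleA -EFinM normal_pdf_mul// -vE EFinM -muleA muleCA.
  over.
rewrite ge0_integralZr//; last 3 first.
- by apply/measurable_EFinP; exact: measurable_normal_pdf.
- by move=> x _; rewrite lee_fin normal_pdf_ge0.
- by rewrite mule_ge0// lee_fin normal_pdf_ge0.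
by rewrite integral_normal_pdf mul1e.
Qed.

End gauss.

(** * One-dimensional slices of the Gaussian vector *)

Section gauss_vec.
Context (R : realType).
Implicit Types (s c : R) (h : R -> \bar R).

(** Induction invariant of the iterated integral: the coordinates below [k] are merged into one
    Gaussian, the others are still read from [v] and only shift the argument. The next coordinate
    enters the convolution with factor [a = u 0 k]. *)
Lemma iter_int_gauss1 (d : nat) (u : 'rV[R]_d) s c h (k : nat) (v : nat -> R) :
  0 <= s -> measurable_fun setT h -> (forall y, 0 <= h y)%E -> (k <= d)%N ->
  iter_int (gauss1 s) k (fun v => h (c + \sum_(i < d) v i * u 0 i)) v =
  (\int[gauss1 (s * Num.sqrt (\sum_(i < d | (i < k)%N) u 0 i ^+ 2))%R]_y
     h (c + \sum_(i < d | (k <= i)%N) v i * u 0 i + y)%R)%E.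
Proof.
move=> s0 mh h0; have mhs b : measurable_fun setT (fun x : R => h (b + x)).
  by apply: measurableT_comp => //; exact: measurable_addl.
elim: k v => [|k IH] v kd.
  by rewrite /= [X in Num.sqrt X]big_pred0// sqrtr0 mulr0 integral_gauss1_0// addr0.
rewrite /=; under eq_setfun_integrand do rewrite (IH _ (ltnW kd)).
pose a := u 0 (Ordinal kd); set S := \sum_(i < d | (i < k)%N) u 0 i ^+ 2.
set b := c + \sum_(i < d | (k < i)%N) v i * u 0 i.
have S0 : 0 <= S by apply: sumr_ge0 => i _; exact: sqr_ge0.
transitivity (\int[gauss1 s]_x \int[gauss1 (s * Num.sqrt S)%R]_y
    h (b + (a * x + y))%R)%E.
  apply: eq_setfun_integrand => x; apply: eq_setfun_integrand => y; congr h.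
  rewrite addrA; congr (_ + y); rewrite /b -addrA; congr (c + _).
  rewrite (bigD1 (Ordinal kd))//= eqxx addrC [x * _]mulrC; congr (_ + _).
  apply: eq_big => [i|i /andP[ki ik]].
    by rewrite ltn_neqAle eq_sym andbC -val_eqE.
  by rewrite ifN.
rewrite (gauss1_convolution a s0 (sqrtr_ge0 S) (mhs b) (fun x => h0 (b + x))).
rewrite (sqr_sqrtr S0).
suff -> : \sum_(i < d | (i < k.+1)%N) u 0 i ^+ 2 = S + a ^+ 2 by [].
rewrite (bigD1 (Ordinal kd))//= addrC; congr (_ + _).
by apply: eq_bigl => i; rewrite ltnS andbC -val_eqE/= -ltn_neqAle.
Qed.

(** The invariant at [k = d]: nothing is left to read from [v], and the unit norm of [u] makes the
    standard deviation exactly [s]. *)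
Lemma gauss_vec_slice (d : nat) (u y : 'rV[R]_d) s (B : set R) :
  0 <= s -> inner u u = 1 -> measurable B ->
  gauss_vec s [set n : 'rV[R]_d | B (inner (y + n)%R u)] =
  (\int[gauss1 s]_z (\1_B (inner y u + z)%R)%:E)%E.
Proof.
move=> s0 u1 mB; rewrite /gauss_vec.
have mB1 : measurable_fun setT (fun x : R => (\1_B x)%:E : \bar R).
  by apply/measurable_EFinP; exact: measurable_indic.
have := @iter_int_gauss1 d u s (inner y u) (fun x => (\1_B x)%:E) d (fun=> 0)
  s0 mB1 (fun x => _) (leqnn d).
rewrite [X in Num.sqrt X](_ : _ = 1); last first.
  by rewrite -u1; apply: eq_big => i; rewrite ?ltn_ord// expr2.
rewrite sqrtr1 mulr1 big_pred0; last by move=> i; rewrite leqNgt ltn_ord.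
rewrite addr0 => <-; last by move=> x; rewrite lee_fin.
congr (iter_int _ _ _ _); apply/funext => v; congr (_%:E).
have yvE : inner (y + \row_(i < d) v i) u = inner y u + \sum_(i < d) v i * u 0 i.
  by rewrite /inner -big_split/=; apply: eq_bigr => i _; rewrite !mxE mulrDl.
rewrite !indicE; congr ((_ : bool)%:R).
by apply/idP/idP; rewrite !inE /= yvE.
Qed.

Lemma gauss_vec_slice_normal (d : nat) (u y : 'rV[R]_d) s (B : set R) :
  0 < s -> inner u u = 1 -> measurable B ->
  gauss_vec s [set n : 'rV[R]_d | B (inner (y + n)%R u)] = normal_prob (inner y u) s B.
Proof.
move=> s0 u1 mB; rewrite gauss_vec_slice ?ltW//.
have mB1 : measurable_fun setT (fun x : R => (\1_B x)%:E : \bar R).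
  by apply/measurable_EFinP; exact: measurable_indic.
have sn : s != 0 by rewrite gt_eqF.
have B0 x : (0 <= (\1_B x)%:E :> \bar R)%E by rewrite lee_fin.
rewrite (ge0_integral_gauss1_shift (inner y u) sn mB1 B0).
rewrite /normal_prob [RHS]integral_mkcond; apply: eq_integral => x _.
by rewrite patchE indicE; case: ifP => _; rewrite ?mule1 ?mule0.
Qed.

Lemma gauss_vec_slice_dirac (d : nat) (u y : 'rV[R]_d) (B : set R) :
  inner u u = 1 -> measurable B ->
  gauss_vec 0 [set n : 'rV[R]_d | B (inner (y + n)%R u)] = (\1_B (inner y u))%:E.
Proof.
move=> u1 mB; rewrite gauss_vec_slice// integral_gauss1_0 ?addr0//.
apply/measurable_EFinP; apply: measurableT_comp; first exact: measurable_indic.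
exact: measurable_addl.
Qed.

End gauss_vec.

(** * Support of a coupling and almost sure distance bounds *)

Section support.
Context (R : realType).

Lemma measurable_dist_gt (r : R) : measurable [set w : R * R | r < `|w.1 - w.2|].
Proof.
have mf : measurable_fun setT (fun w : R * R => `|w.1 - w.2| : R).
  by apply: measurableT_comp => //; exact: measurable_funB.
have := mf measurableT `]r, +oo[%classic (measurable_itv _).
rewrite setTI; congr (measurable _); apply/seteqP; split => w /=;
  by rewrite in_itv/= andbT.
Qed.

Definition box (c : R * R) (e : R) : set (R * R) :=
  [set w : R * R | (`|w.1 - c.1| < e)%R /\ (`|w.2 - c.2| < e)%R].

Lemma measurable_box c e : measurable (box c e).
Proof.
rewrite (_ : box c e = ball c.1 e `*` ball c.2 e).
  by apply: measurableX; exact: measurable_ball.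
by apply/seteqP; split => w; rewrite /box /ball /= /ball_/= (distrC w.1) (distrC w.2).
Qed.

(* The complement of the support is covered by the null boxes of rational centre
   and radius. *)
Lemma supp2_null (pi : probability (R * R)%type R) : pi.-negligible (~` supp2 pi).
Proof.
pose B (k : nat) : set (R * R) :=
  if @unpickle (rat * rat * nat)%type k is Some (q1, q2, n) then
    let b := box (ratr q1, ratr q2) n.+1%:R^-1 in if pi b == 0%E then b else set0
  else set0.
apply: (@negligibleS _ _ _ pi (\bigcup_k B k)); last first.
  apply: negligible_bigcup => k; rewrite /B.
  case: unpickle => [[[q1 q2] n]|]; last exact: negligible_set0.
  case: ifPn => [/eqP pib|_]; last exact: negligible_set0.
  by exists (box (ratr q1, ratr q2) n.+1%:R^-1); split => //; exact: measurable_box.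
move=> z /= /existsNP[e /not_implyP[e0 /negP]]; rewrite -leNgt => pie.
(* A rational centre within [n.+1%:R^-1 < e / 2] of [z], with the same number as radius, gives a box
   that contains [z] and lies inside the null box [box z e]. *)
have e20 : 0 < e / 2 by rewrite divr_gt0.
have [n n_gt] : exists n, n.+1%:R^-1 < e / 2 :> R.
  exists (Num.truncn (e / 2)^-1); rewrite invf_plt ?posrE//.
  exact: truncnS_gt.
have rat_near (x : R) : exists q : rat, `|x - ratr q| < n.+1%:R^-1.
  have xn : x < x + n.+1%:R^-1 by rewrite ltrDl invr_gt0.
  have [q] := rat_in_itvoo xn; rewrite in_itv/= => /andP[xq qn]; exists q.
  by rewrite distrC gtr0_norm ?subr_gt0// ltrBlDl.
move: n_gt rat_near; set dl := n.+1%:R^-1 => n_gt rat_near.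
have [q1 zq1] := rat_near z.1; have [q2 zq2] := rat_near z.2.
have sub : box (ratr q1, ratr q2) dl `<=` box z e.
  move=> w []/= w1 w2; split => /=.
    have -> : w.1 - z.1 = (w.1 - ratr q1) - (z.1 - ratr q1) by ring.
    rewrite (le_lt_trans (ler_normB _ _))//; lra.
  have -> : w.2 - z.2 = (w.2 - ratr q2) - (z.2 - ratr q2) by ring.
  rewrite (le_lt_trans (ler_normB _ _))//; lra.
exists (pickle (q1, q2, n)); first exact: Logic.I.
have -> : B (pickle (q1, q2, n)) = let b := box (ratr q1, ratr q2) dl in
    if pi b == 0%E then b else set0 by rewrite /B pickleK.
cbv zeta; rewrite ifT; first by split.
apply/eqP/le_anti; rewrite measure_ge0 andbT.
apply: (le_trans _ pie); apply: le_measure => //; rewrite inE;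
  exact: measurable_box.
Qed.

(** [W_inf] sees a coupling through its support; since the complement of the support is null, a
    bound on the support holds almost surely. *)
Lemma coupling_dist_null (pi : probability (R * R)%type R) (r : R) :
  (ereal_sup [set (`|z.1 - z.2|)%:E | z in supp2 pi] <= r%:E)%E ->
  pi [set w : R * R | r < `|w.1 - w.2|] = 0%E.
Proof.
move=> supr; have [N [mN N0 sN]] := supp2_null pi.
apply/eqP; rewrite -measure_le0 -N0 le_measure// ?inE//.
  exact: measurable_dist_gt.
apply: subset_trans sN => w /= rw sw; move: rw; apply/negP; rewrite -leNgt.
by rewrite -lee_fin; apply: le_trans supr; apply: ereal_sup_ubound; exists w.
Qed.

End support.

(* Young's inequality for [x] and [l ^ (al - 1)]. *)
Lemma powR_tangent (R : realType) (al l x : R) : 1 < al -> 0 < l -> 0 <= x ->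
  al * l `^ (al - 1) * x <= x `^ al + (al - 1) * l `^ al.
Proof.
move=> al1 l0 x0.
have al0 : 0 < al by lra.
have al10 : 0 < al - 1 by lra.
have aln : al != 0 by rewrite gt_eqF.
have al1n : al - 1 != 0 by rewrite gt_eqF.
have pq : al^-1 + (al / (al - 1))^-1 = 1 by field; rewrite ?aln ?al1n.
(* [al / (al - 1)] is the conjugate exponent of [al], and it turns [l ^ (al - 1)] into [l ^ al]; the
   result is then multiplied by [al]. *)
have := @conjugate_powR R x (l `^ (al - 1)) al (al / (al - 1)) x0 (powR_ge0 _ _)
  al0 (divr_gt0 al0 al10) pq.
rewrite -powRrM mulrCA divff// mulr1 -(ler_pM2l al0) => H.
apply: le_trans (le_trans H _); first by rewrite mulrAC mulrA.
suff -> : al * (x `^ al / al + l `^ al / (al / (al - 1))) =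
  x `^ al + (al - 1) * l `^ al by [].
by field; rewrite ?aln ?al1n.
Qed.

(** * Densities of Gaussian mixtures *)

Section mixture.
Context (R : realType).
Local Notation leb := (@lebesgue_measure R).
Variables (pi : probability (R * R)%type R) (s : R).
Hypothesis s0 : 0 < s.
Let sn : s != 0. Proof. by rewrite gt_eqF. Qed.

(** With [k] equal to [fst] and to [snd] on one coupling, these are the densities of the two
    outputs, written over the same probability. *)
Definition mixture_pdf (k : R * R -> R) (z : R) : R :=
  fine (\int[pi]_w (normal_pdf (k w) s z)%:E)%E.

Section density.
Variable k : R * R -> R.
Hypothesis mk : measurable_fun setT k.

Let mphi : measurable_fun setT
  (fun w : (R * R) * measurableTypeR R => (normal_pdf (k w.1) s w.2)%:E).
Proof.
apply/measurable_EFinP; apply: measurable_normal_pdf_comp => //.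
exact: measurableT_comp.
Qed.

Let mphiz z : measurable_fun setT (fun w => (normal_pdf (k w) s z)%:E).
Proof. by apply/measurable_EFinP; exact: measurable_normal_pdf_comp. Qed.

Let phi_ge0 w z : (0 <= (normal_pdf (k w) s z)%:E)%E.
Proof. by rewrite lee_fin normal_pdf_ge0. Qed.

Lemma mixture_pdfE z :
  (\int[pi]_w (normal_pdf (k w) s z)%:E)%E = (mixture_pdf k z)%:E.
Proof.
rewrite /mixture_pdf fineK// ge0_fin_numE; last by apply: integral_ge0 => w _.
apply: (@le_lt_trans _ _ (\int[pi]_w (normal_peak s)%:E)%E).
  by apply: ge0_le_integral => // w _; rewrite lee_fin normal_pdf_ub.
by rewrite integral_cst//= probability_setT mule1 ltry.
Qed.

(** Positivity makes the quotient of two mixtures meaningful everywhere. A zero integral of the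
    positive integrand would force the whole space to be null, against total mass one. *)
Lemma mixture_pdf_gt0 z : 0 < mixture_pdf k z.
Proof.
rewrite -lte_fin -mixture_pdfE lt0e integral_ge0// andbT.
apply/negP => /eqP int0.
have : ae_eq pi setT (fun w => (normal_pdf (k w) s z)%:E) (cst 0%E).
  apply/ae_eq_integral_abs => //.
  by rewrite -[RHS]int0; apply: eq_integral => w _; rewrite gee0_abs.
move=> [N [mN N0 sN]].
have NT : N = setT.
  apply/seteqP; split => // w _; apply: sN => /= /(_ Logic.I)/eqP.
  by rewrite eqe gt_eqF// normal_pdf_gt0.
have := @probability_setT _ _ _ pi; rewrite -NT N0 => /esym/eqP.
by rewrite onee_eq0.
Qed.

Lemma measurable_mixture_pdf : measurable_fun setT (mixture_pdf k).
Proof.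
have := @measurable_fun_fubini_tonelli_G _ _ _ _ R pi
  (fun w : (R * R) * measurableTypeR R => (normal_pdf (k w.1) s w.2)%:E) mphi.
move=> /(_ (fun w => phi_ge0 w.1 w.2)) mG.
apply/measurable_EFinP; rewrite (_ : EFin \o _ = fun z =>
  \int[pi]_w (normal_pdf (k w) s z)%:E)%E; first exact: mG.
by apply/funext => z /=; rewrite mixture_pdfE.
Qed.

Lemma mixture_density (B : set R) : measurable B ->
  (\int[pi]_w normal_prob (k w) s B = \int[leb]_(z in B) (mixture_pdf k z)%:E)%E.
Proof.
move=> mB.
pose F (w : (R * R) * measurableTypeR R) : \bar R :=
  ((normal_pdf (k w.1) s w.2)%:E * (\1_B w.2)%:E)%E.
have mF : measurable_fun setT F.
  apply: emeasurable_funM => //; apply/measurable_EFinP.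
  by apply: measurableT_comp => //; exact: measurable_indic.
have F0 w : (0 <= F w)%E by rewrite mule_ge0// lee_fin.
transitivity (\int[pi]_w \int[leb]_z F (w, z))%E.
  apply: eq_integral => w _; rewrite /normal_prob [LHS]integral_mkcond.
  by apply: eq_integral => z _; rewrite patchE /F indicE/=; case: ifP => _;
    rewrite ?mule1 ?mule0.
rewrite (@fubini_tonelli _ _ _ _ R pi leb F mF F0) [RHS]integral_mkcond.
apply: eq_integral => z _; rewrite /F /=.
rewrite (@ge0_integralZr _ _ _ pi _ measurableT _ (mphiz z)) ?lee_fin//.
rewrite mixture_pdfE patchE indicE; case: ifP => _; by rewrite ?mule1 ?mule0.
Qed.

End density.
End mixture.

(** * Renyi divergence of two mixtures over one coupling *)

Section renyi_mixture.
Context (R : realType).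
Local Notation leb := (@lebesgue_measure R).
Variables (pi : probability (R * R)%type R) (s al : R).
Hypotheses (s0 : 0 < s) (al1 : 1 < al).
Let sn : s != 0. Proof. by rewrite gt_eqF. Qed.
(** [c * (x - y) ^+ 2] is [al - 1] times the Renyi divergence of order [al] between [N(x, s^2)] and
    [N(y, s^2)]: it is what remains when their exponents, weighted by [al] and [1 - al], are
    completed to a square. *)
Let c := al * (al - 1) / (s ^+ 2 *+ 2).
Let c_ge0 : 0 <= c.
Proof.
by rewrite divr_ge0 ?mulrn_wge0 ?sqr_ge0// mulr_ge0// ?subr_ge0 ltW// (lt_trans _ al1).
Qed.

(* For fixed [w], this is the density [N(w.1, s^2) ^ al * N(w.2, s^2) ^ (1 - al)]. *)
Let K (w : R * R) (z : R) :=
  expR (c * (w.1 - w.2) ^+ 2) * normal_pdf (al * w.1 + (1 - al) * w.2) s z.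

Let KE (w : R * R) z : normal_pdf w.2 s z *
  (normal_pdf w.1 s z / normal_pdf w.2 s z) `^ al = K w z.
Proof.
have Pn : normal_peak s != 0 by rewrite gt_eqF// normal_peak_gt0.
rewrite /K !normal_pdfE// /normal_fun -mulf_div divff// mul1r -expRN -expRD.
rewrite /powR gt_eqF ?expR_gt0// expRK -mulrA [RHS]mulrCA; congr (_ * _).
rewrite -!expRD; congr expR; rewrite /c.
by field; rewrite sn.
Qed.

Let mm : measurable_fun setT (fun w : R * R => al * w.1 + (1 - al) * w.2).
Proof. by apply: measurable_funD; apply: measurable_funM. Qed.

Let mD : measurable_fun setT (fun w : R * R => expR (c * (w.1 - w.2) ^+ 2)).
Proof.
apply: measurableT_comp => //; apply: measurable_funM => //.
by apply: measurable_funX; exact: measurable_funB.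
Qed.

Let mK : measurable_fun setT
  (fun v : (R * R) * measurableTypeR R => (K v.1 v.2)%:E).
Proof.
apply/measurable_EFinP; apply: measurable_funM.
  by apply: (measurableT_comp mD).
apply: measurable_normal_pdf_comp => //.
by apply: (measurableT_comp mm).
Qed.

Let mKz z : measurable_fun setT (fun w => (K w z)%:E).
Proof.
apply/measurable_EFinP; apply: measurable_funM => //.
exact: measurable_normal_pdf_comp.
Qed.

Let K_ge0 w z : 0 <= K w z.
Proof. by rewrite mulr_ge0 ?expR_ge0 ?normal_pdf_ge0. Qed.

Let KEFin_ge0 (v : (R * R) * measurableTypeR R) : (0 <= (K v.1 v.2)%:E)%E.
Proof. by rewrite lee_fin. Qed.

Local Notation p := (mixture_pdf pi s fst).
Local Notation q := (mixture_pdf pi s snd).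
Let p_gt0 z : 0 < p z. Proof. exact: mixture_pdf_gt0. Qed.
Let q_gt0 z : 0 < q z. Proof. exact: mixture_pdf_gt0. Qed.
Let mp : measurable_fun setT p. Proof. exact: measurable_mixture_pdf. Qed.
Let mq : measurable_fun setT q. Proof. exact: measurable_mixture_pdf. Qed.

Let mratio : measurable_fun setT (fun z => p z / q z).
Proof.
under eq_fun do rewrite -powR_inv1 ?(ltW (q_gt0 _))//.
apply: measurable_funM; first exact: mp.
exact: (measurableT_comp (measurable_powR (-1)) mq).
Qed.

(* Integrating the tangent inequality at [l = p z / q z] gives the joint convexity of
   [(a, b) |-> a ^ al * b ^ (1 - al)] without Hoelder's inequality. *)
Lemma mixture_pdf_power_le z :
  ((q z * (p z / q z) `^ al)%:E <= \int[pi]_w (K w z)%:E)%E.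
Proof.
set l := p z / q z; have l0 : 0 < l by rewrite divr_gt0.
have al0 : 0 < al by rewrite (lt_trans _ al1).
have pt w : al * l `^ (al - 1) * normal_pdf w.1 s z <=
    K w z + (al - 1) * l `^ al * normal_pdf w.2 s z.
  have w2 : 0 < normal_pdf w.2 s z by exact: normal_pdf_gt0.
  set x := normal_pdf w.1 s z / normal_pdf w.2 s z.
  have x0 : 0 <= x by rewrite divr_ge0 ?normal_pdf_ge0.
  have := powR_tangent al1 l0 x0; rewrite -(ler_pM2l w2) mulrDr KE.
  rewrite mulrCA [_ * x]mulrC /x divfK ?gt_eqF// => /le_trans -> //.
  by rewrite [_ * ((al - 1) * _)]mulrC.
have mn1 : measurable_fun setT (fun w : R * R => (normal_pdf w.1 s z)%:E).
  by apply/measurable_EFinP; exact: measurable_normal_pdf_comp.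
have mn2 : measurable_fun setT (fun w : R * R => (normal_pdf w.2 s z)%:E).
  by apply/measurable_EFinP; exact: measurable_normal_pdf_comp.
have a0 : 0 <= al * l `^ (al - 1) by rewrite mulr_ge0 ?powR_ge0// ltW.
have b0 : 0 <= (al - 1) * l `^ al by rewrite mulr_ge0 ?powR_ge0// subr_ge0 ltW.
have : ((al * l `^ (al - 1) * p z)%:E <=
    \int[pi]_w (K w z)%:E + ((al - 1) * l `^ al * q z)%:E)%E.
  rewrite EFinM -(mixture_pdfE pi s0 measurable_fst).
  rewrite [X in (_ + X)%E]EFinM -(mixture_pdfE pi s0 measurable_snd).
  rewrite -ge0_integralZl//; last by move=> w _; rewrite lee_fin normal_pdf_ge0.
  rewrite -ge0_integralZl//; last by move=> w _; rewrite lee_fin normal_pdf_ge0.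
  rewrite -ge0_integralD//; last 3 first.
  - by move=> w _; rewrite lee_fin.
  - by move=> w _; rewrite -EFinM lee_fin mulr_ge0// normal_pdf_ge0.
  - exact: measurable_funeM.
  apply: ge0_le_integral => //.
  - by move=> w _; rewrite -EFinM lee_fin mulr_ge0// normal_pdf_ge0.
  - exact: measurable_funeM.
  - by apply: emeasurable_funD => //; exact: measurable_funeM.
  - by move=> w _; rewrite -!EFinM -EFinD lee_fin.
rewrite -leeBlDr// -EFinB; congr (_%:E <= _)%E.
(* As [p z = l * q z], the left side is [al * l ^ al * q z]; subtracting [(al - 1) * l ^ al * q z]
   leaves the wanted term. *)
have pE : p z = l * q z by rewrite /l divfK// gt_eqF.
have lE : l `^ al = l * l `^ (al - 1) by rewrite mulr_powRB1// ltW.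
rewrite pE lE; ring.
Qed.

(** By Tonelli the kernel is integrated in [z] first: its normal factor has mass one, which leaves
    [expR (c * (w.1 - w.2) ^+ 2)], bounded outside the null set where the distance exceeds [r]. *)
Lemma integral_mixture_power_le (r : R) :
  pi [set w : R * R | r < `|w.1 - w.2|] = 0%E -> 0 <= r ->
  (\int[leb]_z (q z * (p z / q z) `^ al)%:E <= (expR (c * r ^+ 2))%:E)%E.
Proof.
move=> pir r0.
have mpw : measurable_fun setT (fun z => q z * (p z / q z) `^ al).
  apply: measurable_funM; first exact: mq.
  exact: (measurableT_comp (measurable_powR al) mratio).
apply: (@le_trans _ _ (\int[leb]_z \int[pi]_w (K w z)%:E)%E).
  apply: ge0_le_integral => //.
  - by move=> z _; rewrite lee_fin mulr_ge0 ?powR_ge0// ltW.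
  - exact/measurable_EFinP.
  - exact: (@measurable_fun_fubini_tonelli_G _ _ _ _ R pi _ mK KEFin_ge0).
  - by move=> z _; exact: mixture_pdf_power_le.
have := @fubini_tonelli _ _ _ _ R pi leb _ mK KEFin_ge0; rewrite /= => <-.
apply: (@le_trans _ _ (\int[pi]_w (expR (c * (w.1 - w.2) ^+ 2))%:E)%E).
  apply: ge0_le_integral => //.
  - by move=> w _; apply: integral_ge0 => z _; rewrite lee_fin.
  - exact: (@measurable_fun_fubini_tonelli_F _ _ _ _ R leb _ mK KEFin_ge0).
  - exact/measurable_EFinP.
  - move=> w _; under eq_integral do rewrite EFinM.
    rewrite ge0_integralZl ?lee_fin ?expR_ge0//; last 2 first.
    + by apply/measurable_EFinP; exact: measurable_normal_pdf.
    + by move=> z _; rewrite lee_fin normal_pdf_ge0.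
    by rewrite integral_normal_pdf mule1.
apply: (@le_trans _ _ (\int[pi]_w (expR (c * r ^+ 2))%:E)%E); last first.
  by rewrite integral_cst//= probability_setT mule1.
apply: ae_ge0_le_integral => //; first exact/measurable_EFinP.
exists [set w : R * R | r < `|w.1 - w.2|]; split => //.
  exact: measurable_dist_gt.
move=> w /= /not_implyP[_ /negP]; apply: contraNT; rewrite -leNgt => wr.
rewrite lee_fin ler_expR ler_wpM2l// -[leLHS]real_normK ?num_real//.
by rewrite lerXn2r// nnegrE.
Qed.

Lemma renyi_mixture_le (P Q : set R -> \bar R) (r : R) :
  pi [set w : R * R | r < `|w.1 - w.2|] = 0%E -> 0 <= r ->
  (forall B, measurable B -> P B = (\int[pi]_w normal_prob w.1 s B)%E) ->
  (forall B, measurable B -> Q B = (\int[pi]_w normal_prob w.2 s B)%E) ->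
  (renyi al P Q <= (al / (s ^+ 2 *+ 2) * r ^+ 2)%:E)%E.
Proof.
move=> pir r0 PE QE.
have QE' B : measurable B -> Q B = (\int[leb]_(z in id @^-1` B) (q z)%:E)%E.
  by move=> mB; rewrite QE// mixture_density.
have al10 : 0 < al - 1 by rewrite subr_gt0.
pose g z := p z / q z.
have g0 z : 0 <= g z by rewrite divr_ge0// ltW.
have mg : measurable_fun setT g.
  exact: mratio.
have intQ h : measurable_fun setT h -> (forall z, 0 <= h z)%E ->
    (\int[Q]_z h z = \int[leb]_z ((q z)%:E * h z))%E.
  move=> mh h0.
  by apply: (@ge0_integral_image_density _ _ (measurableTypeR R) R R leb id q) => // z; exact: ltW.
(* [renyi] is an infimum over densities, so one admissible density is enough: [g = p / q]. *)
apply: (@le_trans _ _ (((al - 1)^-1)%:E * lnE (\int[Q]_x ((g x) `^ al)%:E))%E).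
  apply: ereal_inf_lbound; exists g; split => // B mB.
  rewrite PE// mixture_density//.
  transitivity (\int[Q]_z ((EFin \o g) \_ B) z)%E; last first.
    by rewrite /integral patch_setT.
  rewrite intQ; last 2 first.
  - by apply/(measurable_restrictT _ _).1 => //; apply: measurable_funTS; exact/measurable_EFinP.
  - by move=> z; rewrite patchE; case: ifP => // _; rewrite lee_fin.
  rewrite [LHS]integral_mkcond; apply: eq_integral => z _.
  rewrite !patchE; case: ifP => _; last by rewrite mule0.
  by rewrite /= -EFinM /g mulrC divfK// gt_eqF.
have gint : (\int[Q]_x ((g x) `^ al)%:E <= (expR (c * r ^+ 2))%:E)%E.
  rewrite intQ; last 2 first.
  - by apply/measurable_EFinP; exact: (measurableT_comp (measurable_powR al) mg).
  - by move=> z; rewrite lee_fin powR_ge0.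
  exact: integral_mixture_power_le.
have lnI : (lnE (\int[Q]_x ((g x) `^ al)%:E) <= (c * r ^+ 2)%:E)%E.
  case: integral gint => [x| |]; rewrite ?leye_eq ?leNye//=.
  rewrite !lee_fin => xr.
  (* [ln] is 0 by convention at nonpositive arguments, where the bound is immediate. *)
  have [x0|x0] := leP x 0; first by rewrite ln0// mulr_ge0// sqr_ge0.
  by rewrite -ler_expR lnK.
apply: (@le_trans _ _ (((al - 1)^-1)%:E * (c * r ^+ 2)%:E)%E).
  by rewrite lee_wpmul2l// lee_fin invr_ge0 ltW.
rewrite -EFinM lee_fin /c le_eqVlt; apply/orP; left; apply/eqP.
by field; rewrite sn gt_eqF.
Qed.

End renyi_mixture.

(** * From couplings to bounds by [W_inf], and comparison of laws on rays *)

Section coupling.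
Context (R : realType).
Implicit Types (L : set R -> \bar R) (pi : probability (R * R)%type R).

Lemma coupling_integral1 L1 L2 pi (h : R -> \bar R) : is_coupling L1 L2 pi ->
  measurable_fun setT h -> (forall y, 0 <= h y)%E ->
  (\int[L1]_y h y = \int[pi]_w h w.1)%E.
Proof.
move=> cpi mh h0.
rewrite (@ge0_integral_image_density _ _ _ _ _ pi fst (cst 1))//.
  by apply: eq_integral => w _; rewrite mul1e.
move=> A mA; have [<- _] := cpi A mA.
have mB : measurable (@fst R R @^-1` A).
  by rewrite -[X in measurable X]setTI; exact: measurable_fst.
transitivity (1 * pi (@fst R R @^-1` A))%E; last first.
  exact: (esym (@integral_cst _ _ _ pi _ mB 1%E)).
by rewrite mul1e; congr (pi _); apply/seteqP; split => w //= [].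
Qed.

Lemma coupling_integral2 L1 L2 pi (h : R -> \bar R) : is_coupling L1 L2 pi ->
  measurable_fun setT h -> (forall y, 0 <= h y)%E ->
  (\int[L2]_y h y = \int[pi]_w h w.2)%E.
Proof.
move=> cpi mh h0.
rewrite (@ge0_integral_image_density _ _ _ _ _ pi snd (cst 1))//.
  by apply: eq_integral => w _; rewrite mul1e.
move=> A mA; have [_ <-] := cpi A mA.
have mB : measurable (@snd R R @^-1` A).
  by rewrite -[X in measurable X]setTI; exact: measurable_snd.
transitivity (1 * pi (@snd R R @^-1` A))%E; last first.
  exact: (esym (@integral_cst _ _ _ pi _ mB 1%E)).
by rewrite mul1e; congr (pi _); apply/seteqP; split => w //= [].
Qed.

Lemma measurable_normal_prob s (B : set R) : s != 0 -> measurable B ->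
  measurable_fun setT (fun y : R => normal_prob y s B).
Proof.
move=> sn mB.
pose F (w : R * measurableTypeR R) : \bar R :=
  ((normal_pdf w.1 s w.2)%:E * (\1_B w.2)%:E)%E.
have mF : measurable_fun setT F.
  apply: emeasurable_funM.
    by apply/measurable_EFinP; exact: measurable_normal_pdf_comp.
  apply/measurable_EFinP; apply: measurableT_comp => //; exact: measurable_indic.
have F0 w : (0 <= F w)%E by rewrite mule_ge0// lee_fin// normal_pdf_ge0.
have := @measurable_fun_fubini_tonelli_F _ _ _ _ R lebesgue_measure _ mF F0.
rewrite (_ : fubini_F _ _ = fun y : R => normal_prob y s B)//.
apply/funext => y; rewrite /fubini_F /normal_prob [RHS]integral_mkcond.
by apply: eq_integral => z _; rewrite patchE /F indicE/=; case: ifP => _;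
  rewrite ?mule1 ?mule0.
Qed.

Lemma mulee_ge0 (x : \bar R) : (0 <= x * x)%E.
Proof.
case: x => [x| |]; rewrite ?mulyy ?mulNyNy ?leey// -EFinM lee_fin.
exact: sqr_ge0.
Qed.

(** No optimal coupling is available and [V] may be infinite, so it is shown that every positive
    real [x] below the divergence lies below the right-hand side. *)
Lemma renyi_W_inf_le L1 L2 (P Q : set R -> \bar R) (s al : R) (V : \bar R) :
  0 < s -> 1 < al ->
  (forall B, measurable B -> P B = (\int[L1]_y normal_prob y s B)%E) ->
  (forall B, measurable B -> Q B = (\int[L2]_y normal_prob y s B)%E) ->
  (W_inf L1 L2 <= V)%E ->
  (renyi al P Q <= (al / (s ^+ 2 *+ 2))%:E * (V * V))%E.
Proof.
move=> s0 al1 PE QE WV.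
have sn : s != 0 by rewrite gt_eqF.
set k := al / (s ^+ 2 *+ 2).
have k0 : 0 < k.
  by rewrite divr_gt0 ?(lt_trans _ al1)// mulrn_wgt0// exprn_gt0.
have kVV0 : (0 <= k%:E * (V * V))%E by rewrite mule_ge0 ?mulee_ge0// lee_fin ltW.
have key (x : R) : 0 < x -> (x%:E <= renyi al P Q)%E -> (x%:E <= k%:E * (V * V))%E.
  (* [y] is the distance at which the Gaussian bound [k * y ^+ 2] equals [x]; a coupling with all
     distances at most some [r < y] would push the divergence under [x]. *)
  move=> x0 xr; pose y := Num.sqrt (x / k).
  have xk0 : 0 <= x / k by rewrite ltW// divr_gt0.
  have y0 : 0 < y by rewrite sqrtr_gt0 divr_gt0.
  have yV : (y%:E <= V)%E.
    apply: le_trans WV; apply: le_ereal_inf_tmp => _ [pi /= cpi <-].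
    rewrite leNgt; apply/negP => supy.
    (* The supremum is replaced by a nonnegative real below [y]; the case [-oo] is covered as
       well. *)
    have [r [r0 ry supr]] : exists r : R, [/\ 0 <= r, r < y &
        (ereal_sup [set (`|z.1 - z.2|)%:E | z in supp2 pi] <= r%:E)%E].
      case: ereal_sup supy => [r| |]; rewrite ?ltye_eq//; last first.
        by exists 0; rewrite leNye.
      rewrite lte_fin => ry; exists (Num.max 0 r).
      by rewrite le_max lexx gt_max y0 ry lee_fin le_max lexx orbT.
    have pir := coupling_dist_null supr.
    have := @renyi_mixture_le R pi s al s0 al1 P Q r pir r0.
    move=> /(_ _)/wrap[B mB|]; first rewrite PE//.
      apply: (coupling_integral1 cpi); last by move=> ?; exact: measure_ge0.
      exact: measurable_normal_prob.
    move=> /(_ _)/wrap[B mB|]; first rewrite QE//.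
      apply: (coupling_integral2 cpi); last by move=> ?; exact: measure_ge0.
      exact: measurable_normal_prob.
    move=> /(le_trans xr); rewrite lee_fin; apply/negP; rewrite -ltNge -/k.
    rewrite -ltr_pdivlMl// [ltRHS]mulrC -(sqr_sqrtr xk0) -/y.
    by rewrite ltrXn2r// ltW.
  rewrite -lee_pdivrMl// -EFinM mulrC.
  rewrite (_ : x / k = y * y); last by rewrite -expr2 sqr_sqrtr.
  by rewrite EFinM; apply: lee_pmul => //; rewrite lee_fin ltW.
case: (renyi al P Q) key => [x| |] key.
- by have [x0|x0] := leP x 0; [apply: le_trans kVV0; rewrite lee_fin|exact: key].
- by rewrite leye_eq; apply/eqP/eqyP => x x0; apply: key => //; rewrite leey.
- exact: leNye.
Qed.

(** Up to a null set, [w.1 < x] forces [w.2 < x + r], and symmetrically. Read backwards, a failure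
    of either comparison on a single ray bounds [W_inf] from below. *)
Lemma coupling_ray_le L1 L2 (r x : R) : (W_inf L1 L2 < r%:E)%E ->
  (L1 `]-oo, x[%classic <= L2 `]-oo, (x + r)%R[%classic)%E /\
  (L2 `]-oo, x[%classic <= L1 `]-oo, (x + r)%R[%classic)%E.
Proof.
move=> /ereal_inf_lt[_ [pi /= cpi <-] /ltW/coupling_dist_null pir].
have mI (z : R) : measurable `]-oo, z[%classic by exact: measurable_itv.
have [<- <-] := cpi _ (mI x); have [<- <-] := cpi _ (mI (x + r)).
have mD := @measurable_dist_gt R r.
have mX (z : R) : measurable (`]-oo, z[%classic `*` [set: R]) by exact: measurableX.
have mY (z : R) : measurable ([set: R] `*` `]-oo, z[%classic) by exact: measurableX.
have aux (A B : set (R * R)) : measurable A -> measurable B ->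
    A `<=` B `|` [set w : R * R | r < `|w.1 - w.2|] -> (pi A <= pi B)%E.
  move=> mA mB AB; rewrite -[leRHS]adde0 -pir; apply: le_trans (measureU2 _ mB mD).
  by apply: le_measure => //; rewrite inE//; exact: measurableU.
split; apply: aux => // w /=; rewrite !in_itv/= => -[].
  move=> w1 _; have [wr|wr] := ltP r `|w.1 - w.2|; [by right|left; split => //].
  move: wr; rewrite ler_norml => /andP[? ?]; lra.
move=> _ w2; have [wr|wr] := ltP r `|w.1 - w.2|; [by right|left; split => //].
move: wr; rewrite ler_norml => /andP[? ?]; lra.
Qed.

(** The value on an open left ray is the limit of the values on smaller rays, so countably many
    comparisons with vanishing shifts give the one without shift. *)
Lemma rays_le (nu1 nu2 : {measure set R -> \bar R}) :
  (forall (n : nat) (q : rat),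
     nu1 `]-oo, ratr q[%classic <= nu2 `]-oo, (ratr q + n.+1%:R^-1)%R[%classic)%E ->
  forall x : R, (nu1 `]-oo, x[%classic <= nu2 `]-oo, x[%classic)%E.
Proof.
(* The factor 2 leaves room for a rational [q] above [x - 2 * n.+1%:R^-1] whose shift
   [q + n.+1%:R^-1] stays below [x]. *)
move=> H x; pose F (n : nat) : set R := `]-oo, (x - 2 * n.+1%:R^-1)%R[%classic.
have mI (z : R) : measurable `]-oo, z[%classic by exact: measurable_itv.
have UF : `]-oo, x[%classic = \bigcup_n F n.
  apply/seteqP; split => [z|z [n _]]; rewrite /F /= !in_itv/=; last first.
    by move=> /lt_trans; apply; rewrite ltrBlDr ltrDl mulr_gt0 ?invr_gt0.
  move=> zx; have xz0 : 0 < (x - z) / 2 by rewrite divr_gt0 ?subr_gt0.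
  exists (Num.truncn ((x - z) / 2)^-1) => //=; rewrite in_itv/=.
  have : (Num.truncn ((x - z) / 2)^-1).+1%:R^-1 < (x - z) / 2.
    by rewrite invf_plt ?posrE//; exact: truncnS_gt.
  move: ((_.+1%:R)^-1) => dn; lra.
have ndF : nondecreasing_seq F.
  move=> m n mn; apply/subsetPset => z; rewrite /F /= !in_itv/= => /lt_le_trans; apply.
  by rewrite lerB// ler_pM2l// lef_pV2 ?posrE// ler_nat.
have cF : nu1 \o F @ \oo --> nu1 (\bigcup_n F n).
  by apply: nondecreasing_cvg_mu => //; [move=> n; exact: mI|rewrite -UF].
rewrite UF -(cvg_lim _ cF)//; apply: lime_le; first by apply/cvg_ex; eexists; exact: cF.
apply: nearW => n /=.
have d0 : 0 < n.+1%:R^-1 :> R by rewrite invr_gt0.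
have dd : x - 2 * n.+1%:R^-1 < x - n.+1%:R^-1 by move: (n.+1%:R^-1) d0 => dn; lra.
have [q] := rat_in_itvoo dd; rewrite in_itv/= => /andP[xq qx].
apply: (@le_trans _ _ (nu1 `]-oo, ratr q[%classic)).
  by apply: le_measure; rewrite ?inE//; [exact: mI|
    move=> z; rewrite /F /= !in_itv/= => /lt_trans; apply].
apply: (le_trans (H n q)); rewrite -UF; apply: le_measure; rewrite ?inE//.
by move=> z; rewrite /= !in_itv/= => /lt_trans; apply; rewrite -ltrBrDr.
Qed.

Lemma eq_rays_eq_measure (nu1 nu2 : {measure set R -> \bar R}) :
  (nu1 setT < +oo)%E ->
  (forall x : R, nu1 `]-oo, x[%classic = nu2 `]-oo, x[%classic) ->
  forall A, measurable A -> nu1 A = nu2 A.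
Proof.
move=> nu1oo H A mA.
have mI (z : R) : measurable `]-oo, z[%classic by exact: measurable_itv.
apply: (@measure_unique _ R R (@RGenInftyO.G R) (fun n => `]-oo, n%:R[%classic)) => //.
- exact: (@RGenInftyO.measurableE R).
- move=> _ _ [x ->] [y ->]; exists (Num.min x y).
  by apply/seteqP; split => z /=; rewrite !in_itv/= lt_min => /andP.
- by move=> n; exists n%:R.
- apply/seteqP; split => // z _; exists (Num.truncn z).+1 => //=.
  by rewrite in_itv/=; exact: truncnS_gt.
- by move=> _ [x ->]; exact: H.
- move=> n; apply: le_lt_trans nu1oo; apply: le_measure; rewrite ?inE//.
Qed.

(** The constant density 1 is admissible, and the logarithm of the total mass one vanishes. *)
Lemma renyi_eq_le0 (P Q : set R -> \bar R) (al : R) (nu : {measure set R -> \bar R}) :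
  nu setT = 1%E -> (forall A, measurable A -> P A = nu A) ->
  (forall A, measurable A -> Q A = nu A) ->
  (renyi al P Q <= 0)%E.
Proof.
move=> nuT PE QE.
have int1 A : measurable A -> (\int[nu]_(x in A) 1%:E = nu A)%E.
  by move=> mA; rewrite -[RHS]mul1e; exact: (@integral_cst _ _ _ nu _ mA 1%E).
apply: ereal_inf_lbound; exists (cst 1); split => //.
  by move=> A mA; rewrite (eq_setfun_integral _ _ QE) PE// -int1.
rewrite (eq_setfun_integral _ _ QE) (_ : integral _ _ _ = 1%E).
  by rewrite /= ln1 mule0.
rewrite -[RHS]nuT -int1//.
by apply: eq_integral => x _; rewrite powR1.
Qed.

End coupling.

Lemma measurable_inner (R : realType) d (T : measurableType d) (n : nat)
    (a b : T -> 'rV[R]_n) :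
  (forall i, measurable_fun setT (fun t => a t 0 i)) ->
  (forall i, measurable_fun setT (fun t => b t 0 i)) ->
  measurable_fun setT (fun t => inner (a t) (b t)).
Proof.
by move=> ma mb; apply: measurable_sum => i; exact: measurable_funM.
Qed.

(** * Conditional query laws and slices of the mechanism *)

Section conditional_law.
Context (R : realType) (dS dX : measure_display) (Sec : measurableType dS)
  (X : measurableType dX) (d : nat).
Variables (theta : probability (Sec * X)%type R) (f : X -> 'rV[R]_d) (s : Sec)
  (u : 'rV[R]_d).
Hypotheses (ms : measurable [set s])
  (mf : forall i, measurable_fun setT (fun x => f x 0 i))
  (s_gt0 : (0 < secret_prob theta s)%E).

Let E : set (Sec * X) := [set p | p.1 = s].
Let c := fine (secret_prob theta s).
Let Y (p : Sec * X) := inner (f p.2) u.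
(** Conditioning as a weight: the slice of the conditional law is the image under [Y] of [theta]
    weighted by [wt]. *)
Let wt (p : Sec * X) : R := c^-1 * \1_E p.

Local Notation L := (slice_push u (cond_query_law theta f s)).

Let mE : measurable E.
Proof.
rewrite (_ : E = fst @^-1` [set s])// -[X in measurable X]setTI.
exact: measurable_fst.
Qed.

Let mY : measurable_fun setT Y.
Proof.
apply: measurable_inner => i //.
by apply: (measurableT_comp (mf i)); exact: measurable_snd.
Qed.

Let thetaE : theta E = c%:E.
Proof. by rewrite /c fineK// fin_num_measure. Qed.

Let c_gt0 : 0 < c.
Proof. by rewrite -lte_fin -thetaE; exact: s_gt0. Qed.

Let mwt : measurable_fun setT wt.
Proof. by apply: measurable_funM => //; exact: measurable_indic. Qed.

Let wt_ge0 p : 0 <= wt p.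
Proof. by rewrite mulr_ge0 ?invr_ge0 ?(ltW c_gt0). Qed.

Let condE (A : set R) : measurable A ->
  L A = (\int[theta]_(p in Y @^-1` A) (wt p)%:E)%E.
Proof.
move=> mA; have mYA : measurable (Y @^-1` A).
  by rewrite -[X in measurable X]setTI; exact: mY.
under eq_integral do rewrite EFinM.
rewrite ge0_integralZl ?lee_fin ?invr_ge0 ?(ltW c_gt0)//; last first.
  by apply/measurable_EFinP; exact: measurable_indic.
rewrite integral_indic// /slice_push /cond_query_law -/c mulrC EFinM fineK.
  by congr (_ * theta _)%E.
rewrite (_ : [set p | _] = E `&` Y @^-1` A)// fin_num_measure//.
exact: measurableI.
Qed.

(** The comparison of laws on rays needs genuine measures, whereas [cond_query_law] is only a set
    function built with [fine]. *)
Lemma cond_law_measure : exists2 nu : {measure set R -> \bar R},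
  nu setT = 1%E & forall A, measurable A -> L A = nu A.
Proof.
have [nu nuE] := image_density_measure theta mY mwt wt_ge0.
exists nu => [|A mA]; last by rewrite condE// nuE.
rewrite nuE -condE// /slice_push /cond_query_law -/c.
rewrite (_ : [set p | _] = E); last by apply/seteqP; split => p // [].
by rewrite thetaE /= divff// gt_eqF.
Qed.

(** The bound [k <= 1] keeps the integral over the event finite, so that [fine] loses nothing; it is
    applied to the normal probability of a fixed set as a function of the mean. *)
Lemma integral_cond_law (k : R -> \bar R) : measurable_fun setT k ->
  (forall y, 0 <= k y)%E -> (forall y, k y <= 1)%E ->
  (\int[L]_y k y)%E = (fine (\int[theta]_(p in E) k (Y p)) / c)%:E.
Proof.
move=> mk k0 k1.
have mkY : measurable_fun setT (k \o Y) by exact: measurableT_comp.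
rewrite (ge0_integral_image_density mY mwt wt_ge0 condE mk k0).
have -> : (\int[theta]_p ((wt p)%:E * k (Y p)) =
    (c^-1)%:E * \int[theta]_(p in E) k (Y p))%E.
  rewrite [in RHS]integral_mkcond -ge0_integralZl//; last 3 first.
  - exact/(measurable_restrictT _ _).1/measurable_funTS.
  - by move=> p _; rewrite patchE; case: ifP.
  - by rewrite lee_fin invr_ge0 ltW.
  apply: eq_integral => p _; rewrite /wt EFinM -muleA; congr (_ * _)%E.
  by rewrite patchE indicE; case: ifP => _; rewrite ?mul1e ?mul0e.
rewrite mulrC EFinM fineK//.
rewrite ge0_fin_numE; last by apply: integral_ge0 => p _; exact: k0.
apply: (@le_lt_trans _ _ (\int[theta]_(p in E) (cst 1 p))%E).
  by apply: ge0_le_integral => //; exact: measurable_funTS.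
by rewrite integral_cst// mul1e -ge0_fin_numE// fin_num_measure.
Qed.

Hypothesis u1 : inner u u = 1.

Lemma slice_gauss_mech_normal (var : R) (B : set R) : 0 < var -> measurable B ->
  slice_push u (gauss_mech_law f var theta s) B =
  (\int[L]_y normal_prob y (Num.sqrt var) B)%E.
Proof.
move=> v0 mB; have sv0 : 0 < Num.sqrt var by rewrite sqrtr_gt0.
rewrite integral_cond_law; last 3 first.
- by apply: measurable_normal_prob => //; rewrite gt_eqF.
- by move=> y; exact: measure_ge0.
- by move=> y; exact: probability_le1.
rewrite /slice_push /gauss_mech_law; congr (fine _ / _)%:E.
by apply: eq_integral => p _; exact: gauss_vec_slice_normal.
Qed.

Lemma slice_gauss_mech_dirac (B : set R) : measurable B ->
  slice_push u (gauss_mech_law f 0 theta s) B = L B.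
Proof.
move=> mB; rewrite /slice_push /gauss_mech_law /cond_query_law sqrtr0.
congr (fine _ / _)%:E.
transitivity (\int[theta]_(p in E) (\1_(Y @^-1` B) p)%:E)%E.
  by apply: eq_integral => p _; exact: gauss_vec_slice_dirac.
rewrite integral_indic//; last first.
  by rewrite -[X in measurable X]setTI; exact: mY.
by rewrite setIC.
Qed.

End conditional_law.

(** * Vanishing mean squared sensitivity *)

Section zero_noise.
Context (R : realType) (dS dX dD : measure_display) (Sec : measurableType dS)
  (X : measurableType dX) (D : measurableType dD) (d : nat).
Variables (f : X -> 'rV[R]_d) (omega : probability D R) (dir : D -> 'rV[R]_d).
Hypotheses (mS : forall s : Sec, measurable [set s])
  (dir1 : forall t, inner (dir t) (dir t) = 1)
  (mdir : forall i, measurable_fun setT (fun t => dir t 0 i))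
  (mf : forall i, measurable_fun setT (fun x => f x 0 i)).
Variables (theta : probability (Sec * X)%type R) (si sj : Sec).
Hypotheses (si0 : (0 < secret_prob theta si)%E) (sj0 : (0 < secret_prob theta sj)%E).

Let L s t := slice_push (dir t) (cond_query_law theta f s).

(** Up to normalisation this is the [theta]-mass of the section at [t] of a measurable subset of the
    product, hence measurable in [t]. *)
Lemma measurable_slice_ray (s : Sec) (x : R) :
  measurable_fun setT (fun t => L s t `]-oo, x[%classic).
Proof.
pose Z : set (D * (Sec * X)) :=
  [set w | w.2.1 = s /\ inner (f w.2.2) (dir w.1) < x].
have mZ : measurable Z.
  pose g (w : D * (Sec * X)) := inner (f w.2.2) (dir w.1).
  have mg : measurable_fun setT g.
    apply: measurable_inner => i.
      apply: (measurableT_comp (mf i)).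
      exact: (measurableT_comp measurable_snd measurable_snd).
    by apply: (measurableT_comp (mdir i)); exact: measurable_fst.
  have mfs : measurable_fun setT (fun w : D * (Sec * X) => w.2.1).
    exact: (measurableT_comp measurable_fst measurable_snd).
  rewrite (_ : Z = ((fun w : D * (Sec * X) => w.2.1) @^-1` [set s]) `&`
    (g @^-1` `]-oo, x[%classic)); last first.
    by apply/seteqP; split => w /=; rewrite in_itv.
  apply: measurableI; rewrite -[X in measurable X]setTI; first exact: mfs.
  by apply: mg.
have := measurable_fun_xsection theta mZ; rewrite /L /slice_push /cond_query_law.
move=> mZx; apply/measurable_EFinP; apply: measurable_funM => //.
rewrite (_ : (fun t => _) = fine \o (theta \o xsection Z)).
  by apply: measurableT_comp.
apply/funext => t /=; congr (fine (theta _)); apply/seteqP.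
by split => p; rewrite /xsection /Z /= inE/= in_itv.
Qed.

(** The directions in which the shifted comparison of rays fails at a rational point. These sets are
    countably many, and together, over both orders of the pair, they detect all directions with
    distinct slices. *)
Definition ray_gap (a b : Sec) (n : nat) (q : rat) : set D :=
  [set t | (L b t `]-oo, (ratr q + n.+1%:R^-1)%R[%classic < L a t `]-oo, ratr q[%classic)%E].

Lemma measurable_ray_gap a b n q : measurable (ray_gap a b n q).
Proof.
rewrite -[X in measurable X]setTI.
by apply: measurable_lte => //; exact: measurable_slice_ray.
Qed.

Lemma ray_gapN_eq_slice t :
  (forall n q, ~ ray_gap si sj n q t) -> (forall n q, ~ ray_gap sj si n q t) ->
  forall A, measurable A -> L si t A = L sj t A.
Proof.
move=> gij gji.
have mI (z : R) : measurable `]-oo, z[%classic by exact: measurable_itv.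
have [nui nuiT nuiE] := cond_law_measure (dir t) (mS si) mf si0.
have [nuj nujT nujE] := cond_law_measure (dir t) (mS sj) mf sj0.
move=> A mA; rewrite /L nuiE// nujE//.
apply: eq_rays_eq_measure => //; first by rewrite nuiT ltry.
move=> x; apply/le_anti/andP; split; apply: rays_le => n q;
  rewrite -!nuiE// -!nujE// leNgt; apply/negP; [exact: gij|exact: gji].
Qed.

Lemma ray_gap_W_inf t n q : ray_gap si sj n q t \/ ray_gap sj si n q t ->
  ((n.+1%:R^-1)%:E <= W_inf (L si t) (L sj t))%E.
Proof.
move=> gap; rewrite leNgt; apply/negP => /(coupling_ray_le (ratr q))[ij ji].
by case: gap; rewrite /ray_gap/= ltNge ?ij ?ji.
Qed.

(* The sensitivity need not be measurable; the sets [ray_gap] are measurable, cover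
   the directions with distinct slices, and bound the sensitivity from below. *)
Lemma AveSD_zero_noise_le0 (al : R) (V : D -> \bar R) :
  (forall t, W_inf (L si t) (L sj t) <= V t)%E ->
  (\int[omega]_t (V t * V t) = 0)%E ->
  (AveSD omega dir al (gauss_mech_law f 0 theta si) (gauss_mech_law f 0 theta sj) <= 0)%E.
Proof.
move=> WV V0.
have gap0 (a b : Sec) n q : (ray_gap a b n q `<=`
    [set t | ray_gap si sj n q t \/ ray_gap sj si n q t]) ->
    omega (ray_gap a b n q) = 0%E.
  move=> sub; have mG := measurable_ray_gap a b n q.
  have r0 : 0 < n.+1%:R^-1 :> R by rewrite invr_gt0.
  (* Markov's inequality: on the gap [V] is at least [n.+1%:R^-1], so the square of this constant
     times the indicator lies below [V * V], whose integral vanishes. *)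
  have := @le_scaled_integral _ _ R omega 1
    (fun t => ((n.+1%:R^-1) ^+ 2)%:E * (\1_(ray_gap a b n q) t)%:E)%E
    (fun t => V t * V t)%E ltr01 (fun t => mulee_ge0 (V t)).
  rewrite V0 mule0 => /(_ _)/wrap[t|].
    rewrite mul1e indicE; case: (boolP (t \in _)) => [/set_mem/sub gap|_]; last first.
      by rewrite mule0 mulee_ge0.
    have := le_trans (ray_gap_W_inf gap) (WV t) => rV.
    by rewrite mule1 expr2 EFinM lee_pmul// lee_fin ltW.
  rewrite ge0_integralZl ?lee_fin ?sqr_ge0//; last first.
    by apply/measurable_EFinP; exact: measurable_indic.
  rewrite integral_indic// setIT => le0; apply/eqP; rewrite -measure_le0.
  by rewrite -(@lee_pmul2l _ ((n.+1%:R^-1) ^+ 2)%:E) ?mule0// lte_fin exprn_gt0.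
pose G (k : nat) : set D := if @unpickle (nat * rat)%type k is Some (n, q) then
  ray_gap si sj n q `|` ray_gap sj si n q else set0.
have mG k : measurable (G k).
  rewrite /G; case: unpickle => [[n q]|//].
  by apply: measurableU; exact: measurable_ray_gap.
have G0 k : omega.-negligible (G k).
  rewrite /G; case: unpickle => [[n q]|]; last exact: negligible_set0.
  apply: negligibleU.
    by exists (ray_gap si sj n q); split;
      [exact: measurable_ray_gap|apply: gap0 => t; left|].
  by exists (ray_gap sj si n q); split;
    [exact: measurable_ray_gap|apply: gap0 => t; right|].
pose Z := \bigcup_k G k.
have mZ : measurable Z by exact: bigcupT_measurable.
have Z0 : omega Z = 0%E.
  exact/(@measure_negligible _ _ _ omega)/negligible_bigcup.
(* Infinity on a null set integrates to zero, so this function dominates the divergence without any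
   control of it on [Z]. *)
have int0 : (\int[omega]_t ((cst +oo) \_ Z) t = 0)%E.
  transitivity (+oo * omega Z)%E; last by rewrite Z0 mule0.
  by rewrite -integral_mkcond; exact: (@integral_cst _ _ _ omega _ mZ +oo%E).
have := @le_scaled_integral _ _ R omega 1
    (fun t => renyi al (slice_push (dir t) (gauss_mech_law f 0 theta si))
                       (slice_push (dir t) (gauss_mech_law f 0 theta sj)))
    ((cst +oo%E) \_ Z) ltr01.
rewrite mul1e int0; apply.
  by move=> t; rewrite patchE; case: ifP => _; rewrite ?leey.
move=> t; rewrite mul1e patchE; case: ifPn => [_|/negP tZ]; first by rewrite leey.
have gapN a b n q : ray_gap a b n q `<=` G (pickle (n, q)) -> ~ ray_gap a b n q t.
  by move=> sub gap; apply: tZ; rewrite inE; exists (pickle (n, q)) => //; exact: sub.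
have LE : forall A, measurable A -> L si t A = L sj t A.
  apply: ray_gapN_eq_slice => n q; apply: gapN => t'; rewrite /G pickleK;
    by [left|right].
have [nuj nujT nujE] := cond_law_measure (dir t) (mS sj) mf sj0.
apply: (renyi_eq_le0 _ nujT) => A mA; rewrite slice_gauss_mech_dirac//.
  by rewrite -nujE//; exact: LE.
exact: nujE.
Qed.

End zero_noise.

Theorem theorem1 (R : realType) (d : nat)
  (dS : measure_display) (Sec : measurableType dS)
  (dX : measure_display) (X : measurableType dX)
  (Q : set (Sec * Sec)%type) (Theta : set (probability (Sec * X)%type R))
  (U : set 'rV[R]_d)
  (dD : measure_display) (D : measurableType dD) (omega : probability D R)
  (dir : D -> 'rV[R]_d)
  (alpha eps : R) (f : X -> 'rV[R]_d) :
  (forall s : Sec, measurable [set s]) ->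
  U `<=` unit_sphere (d:=d) ->
  (forall t, U (dir t)) ->
  (forall i, measurable_fun setT (fun t => dir t 0 i)) ->
  (forall i, measurable_fun setT (fun x => f x 0 i)) ->
  1 < alpha -> 0 < eps ->
  mean_sq_sens Q Theta f omega dir \is a fin_num ->
  Ave_SRPP Q Theta omega dir alpha eps
    (gauss_mech_law f (alpha * fine (mean_sq_sens Q Theta f omega dir) / (2 * eps))).
Proof.
move=> mS Usub Udir mdir mf al1 eps0 fin theta si sj Ttheta Qij si0 sj0.
have dir1 t : inner (dir t) (dir t) = 1 by exact: Usub (Udir t).
set m := mean_sq_sens Q Theta f omega dir in fin *.
pose V t := slice_sens Q Theta f (dir t).
have WV t : (W_inf (slice_push (dir t) (cond_query_law theta f si))
                   (slice_push (dir t) (cond_query_law theta f sj)) <= V t)%E.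
  by apply: ereal_sup_ubound; exists theta, si, sj.
have mE : (\int[omega]_t (V t * V t))%E = (fine m)%:E by rewrite fineK.
have m_ge0 : 0 <= fine m.
  by rewrite -lee_fin -mE; apply: integral_ge0 => t _; exact: mulee_ge0.
have al0 : 0 < alpha by rewrite (lt_trans _ al1).
(* When [fine m = 0] the variance is zero and the noise is a Dirac mass; the Gaussian bound would
   divide by zero. *)
move: m_ge0; rewrite le_eqVlt => /predU1P[m0|m_gt0].
  rewrite -m0 mulr0 mul0r.
  apply: le_trans (_ : _ <= 0)%E _; last by rewrite lee_fin ltW.
  apply: (@AveSD_zero_noise_le0 _ _ _ _ _ _ _ _ _ _ _ mS dir1 mdir mf
    theta si sj si0 sj0 _ V) => //.
  by rewrite mE -m0.
set var := alpha * fine m / (2 * eps).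
have var0 : 0 < var by rewrite divr_gt0 ?mulr_gt0.
have k0 : 0 < alpha / (Num.sqrt var ^+ 2 *+ 2).
  by rewrite divr_gt0// mulrn_wgt0// exprn_gt0// sqrtr_gt0.
rewrite /AveSD; apply: (le_trans (le_scaled_integral omega k0 (fun t => mulee_ge0 (V t)) _)).
  move=> t; apply: (renyi_W_inf_le _ al1 _ _ (WV t)).
  - by rewrite sqrtr_gt0.
  - by move=> B mB; exact: slice_gauss_mech_normal.
  - by move=> B mB; exact: slice_gauss_mech_normal.
(* The variance is chosen so that [alpha / (2 * var) * fine m] equals [eps]. *)
rewrite mE -EFinM lee_fin (sqr_sqrtr (ltW var0)) le_eqVlt; apply/orP; left; apply/eqP.
by rewrite /var; field; rewrite !gt_eqF.
Qed.
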